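(* Let $d,N\ge1$ be integers and let $\boldsymbol v_\theta:\mathbb{R}^d\times[0,1]\to\mathbb{R}^d$ be a smooth vector field such that for every multi-index $\beta\in\mathbb{N}_0^{d+1}$ (including $\beta=0$) there is a constant $M_\beta$ with $\sup_{\mathbf x\in\mathbb{R}^d,\,t\in[0,1]}|\partial^\beta\boldsymbol v_\theta(\mathbf x,t)|\le M_\beta$. Let $\boldsymbol\tau=\tilde{\boldsymbol\tau}\circ G:(0,1)^d\to\mathbb{R}^d$, where $G$ is the component-wise inverse logistic map and $\tilde{\boldsymbol\tau}$ is the Euler-discretized flow map generated by $\boldsymbol v_\theta$ (see context), and let $F(x)=(1+e^{-x})^{-1}$. Then: 1. There is a constant $C_4>0$ such that for all $j\in\{1,\dots,d\}$ and $\mathbf u\in(0,1)^d$, $$\min\big(F(\boldsymbol\tau_j(\mathbf u)),\,1-F(\boldsymbol\tau_j(\mathbf u))\big)^{-1}\le C_4\min(u_j,1-u_j)^{-1}.$$ In particular, $\min(F(\boldsymbol\tau_j(\mathbf u)),1-F(\boldsymbol\tau_j(\mathbf u)))^{-1}\le C_4\prod_{l=1}^d\min(u_l,1-u_l)^{-B_0}$ holds with $B_0=1$. 2. There is a constant $C'$ such that for all $j\in\{1,\dots,d\}$ and $\mathbf u\in(0,1)^d$, $$|\boldsymbol\tau_j(\mathbf u)|\ge|\ln(\min(u_j,1-u_j))|-C',$$ i.e. the bound $|\boldsymbol\tau_j(\mathbf u)|\ge C_5|\ln(\min(u_j,1-u_j))|-C'$ holds with $C_5=1$.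
   Context: $G(\mathbf u)=(G(u_1),\dots,G(u_d))$ with $G(u)=\log\frac{u}{1-u}$ for $u\in(0,1)$. With step size $\eta=1/N$ and $t_k=k\eta$, the Euler step maps are $\boldsymbol\tau^k(\mathbf x)=\mathbf x+\eta\,\boldsymbol v_\theta(\mathbf x,t_k)$, $k=0,\dots,N-1$, and the discretized flow map is $\tilde{\boldsymbol\tau}=\boldsymbol\tau^{N-1}\circ\cdots\circ\boldsymbol\tau^0$. $\boldsymbol\tau_j$ denotes the $j$-th component of $\boldsymbol\tau$. *)

(* Defs.v *)
From HB Require Import structures.
From mathcomp Require Import all_boot all_order all_algebra.
From mathcomp Require Import all_classical all_reals all_analysis.
Set Implicit Arguments.
Unset Strict Implicit.
Unset Printing Implicit Defensive.
Import Order.TTheory GRing.Theory Num.Theory.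
Import numFieldNormedType.Exports.
Local Open Scope classical_set_scope.
Local Open Scope ring_scope.

Section SmoothField.
Context (R : realType) (d : nat).

(* Fields on R^d x [0, 1] are total functions on R^d x R; everything below
   only looks at their values on the slab. *)
Definition slab : set ('rV[R]_d * R) := [set p | 0 <= p.2 <= 1].

(* Directions are indexed by 'I_d.+1: the first d are spatial, the last one,
   ord_max, is time. *)
Definition direction (i : 'I_d.+1) : 'rV[R]_d * R :=
  if unlift ord_max i is Some j then (delta_mx 0 j, 0) else (0, 1).

Definition diff_quotient (i : 'I_d.+1) (f : 'rV[R]_d * R -> 'rV[R]_d)
    (p : 'rV[R]_d * R) (h : R) : 'rV[R]_d :=
  h^-1 *: (f (h *: direction i + p) - f p).

(* The increments h that keep p + h e_i in the slab: for a spatial direction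
   this is the usual 0^', for the time direction the difference quotient is
   one-sided at t = 0 and at t = 1. *)
Definition increments (i : 'I_d.+1) (p : 'rV[R]_d * R) : set_system R :=
  within [set h | slab (h *: direction i + p)] 0^'.

Definition pderivable (i : 'I_d.+1) (f : 'rV[R]_d * R -> 'rV[R]_d)
    (p : 'rV[R]_d * R) : Prop :=
  cvg (diff_quotient i f p @ increments i p).

Definition pderiv (i : 'I_d.+1) (f : 'rV[R]_d * R -> 'rV[R]_d)
    (p : 'rV[R]_d * R) : 'rV[R]_d :=
  lim (diff_quotient i f p @ increments i p).

Definition pderivs (s : seq 'I_d.+1) (f : 'rV[R]_d * R -> 'rV[R]_d) :
    'rV[R]_d * R -> 'rV[R]_d :=
  foldr pderiv f s.

Definition smooth_on_slab (f : 'rV[R]_d * R -> 'rV[R]_d) : Prop :=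
  forall s : seq 'I_d.+1,
    {within slab, continuous (pderivs s f)} /\
    (forall (i : 'I_d.+1) p, slab p -> pderivable i (pderivs s f) p).

Definition multi_pderiv (beta : {ffun 'I_d.+1 -> nat})
    (f : 'rV[R]_d * R -> 'rV[R]_d) : 'rV[R]_d * R -> 'rV[R]_d :=
  pderivs (flatten [seq nseq (beta i) i | i <- enum 'I_d.+1]) f.

(* `|_| is the library's norm on 'rV[R]_d (maximum of the coordinates); as the
   bound depends on beta, any norm on R^d gives the same condition. *)
Definition bounded_derivatives (f : 'rV[R]_d * R -> 'rV[R]_d) : Prop :=
  forall beta : {ffun 'I_d.+1 -> nat},
    exists M : R, forall p, slab p -> `|multi_pderiv beta f p| <= M.

End SmoothField.

Section EulerFlow.
Context (R : realType) (d : nat).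

Definition logit (u : R) : R := ln (u / (1 - u)).

Definition logistic (x : R) : R := (1 + expR (- x))^-1.

Definition euler_step (v : 'rV[R]_d * R -> 'rV[R]_d) (N k : nat)
    (x : 'rV[R]_d) : 'rV[R]_d :=
  let eta : R := N%:R^-1 in
  x + eta *: v (x, k%:R * eta).

Fixpoint euler_iter (v : 'rV[R]_d * R -> 'rV[R]_d) (N n : nat)
    (x : 'rV[R]_d) : 'rV[R]_d :=
  if n is k.+1 then euler_step v N k (euler_iter v N k x) else x.

Definition euler_flow (v : 'rV[R]_d * R -> 'rV[R]_d) (N : nat) :
    'rV[R]_d -> 'rV[R]_d :=
  euler_iter v N N.

(* Meaningful for u in the open unit cube only. *)
Definition transport (v : 'rV[R]_d * R -> 'rV[R]_d) (N : nat)
    (u : 'rV[R]_d) : 'rV[R]_d :=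
  euler_flow v N (map_mx logit u).

Definition open_cube : set 'rV[R]_d := [set u | forall l, 0 < u 0 l < 1].

End EulerFlow.

(* Main.v *)
(** The Euler flow moves each coordinate by at most M = sup |v| (N steps of
    length M / N), so |tau_j(u) - G(u_j)| <= M.  Since
      min(F(x), 1 - F(x))^-1 = 1 + e^|x|   and   F(G(u)) = u,
    part 1 reads 1 + e^|tau_j| <= C_4 (1 + e^|G(u_j)|), true for C_4 = e^M,
    and part 2 follows from
      |ln min(u_j, 1 - u_j)| = ln (1 + e^|G(u_j)|) <= |G(u_j)| + ln 2. *)
Require Import Defs.
From HB Require Import structures.
From mathcomp Require Import all_boot all_order all_algebra.
From mathcomp Require Import all_classical all_reals all_analysis.
From mathcomp Require Import ring.
Set Implicit Arguments.
Unset Strict Implicit.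
Unset Printing Implicit Defensive.
Import Order.TTheory GRing.Theory Num.Theory.
Import numFieldNormedType.Exports.
Local Open Scope classical_set_scope.
Local Open Scope ring_scope.

Section BoundedEulerFlow.
Context (R : realType) (d : nat).
Implicit Types (v : 'rV[R]_d * R -> 'rV[R]_d) (x u : 'rV[R]_d).

(** For the zero multi-index the list of directions is empty, so [multi_pderiv] returns [v]
    itself. *)
Lemma bounded_derivatives_bounded v : bounded_derivatives v ->
  exists M : R, forall p, slab p -> `|v p| <= M.
Proof.
move=> /(_ [ffun=> 0%N])[M vM]; exists M => p /vM.
rewrite /multi_pderiv; suff -> : flatten
  [seq nseq ([ffun=> 0%N] i) i | i <- enum 'I_d.+1] = [::] by [].
by elim: (enum _) => //= i s ->; rewrite ffunE.
Qed.

(** Induction on [n] with the triangle inequality: each Euler step moves the point by at most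
    [M / N]. *)
Lemma euler_iter_dist v (M : R) (N n : nat) x :
  (forall p, slab p -> `|v p| <= M) -> (0 < N)%N -> (n <= N)%N ->
  `|euler_iter v N n x - x| <= n%:R / N%:R * M.
Proof.
move=> vM N0; elim: n => [|n IHn] nN /=; first by rewrite subrr normr0 !mul0r.
rewrite /euler_step addrAC (le_trans (ler_normD _ _))//.
rewrite -natr1 !mulrDl mul1r lerD ?IHn 1?ltnW//.
rewrite normrZ ger0_norm ?invr_ge0// ler_wpM2l ?invr_ge0// vM//.
(* The last step evaluates [v] at time [n / N], which stays in [0, 1] because [n < N]. *)
by rewrite /slab/= divr_ge0//= ler_pdivrMr ?ltr0n// mul1r ler_nat ltnW.
Qed.

Lemma euler_flow_dist v (M : R) (N : nat) x :
  (forall p, slab p -> `|v p| <= M) -> (0 < N)%N ->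
  `|euler_flow v N x - x| <= M.
Proof.
move=> vM N0; have := euler_iter_dist x vM N0 (leqnn N).
by rewrite divff ?mul1r// pnatr_eq0 -lt0n.
Qed.

Lemma ler_norm_coord x (j : 'I_d) : `|x 0 j| <= `|x|.
Proof.
rewrite [leRHS]mx_normrE.
exact: (le_bigmax _ (fun i : 'I_1 * 'I_d => `|x i.1 i.2|) (0, j)).
Qed.

Lemma transport_dist v (M : R) (N : nat) u (j : 'I_d) :
  (forall p, slab p -> `|v p| <= M) -> (0 < N)%N ->
  `|transport v N u 0 j - logit (u 0 j)| <= M.
Proof.
move=> vM N0; apply: le_trans (euler_flow_dist (map_mx (@logit R) u) vM N0).
by have := ler_norm_coord (transport v N u - map_mx (@logit R) u) j; rewrite !mxE.
Qed.

End BoundedEulerFlow.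

Section Logistic.
Context (R : realType).
Implicit Types x y u : R.

Lemma logisticN x : logistic (- x) = 1 - logistic x.
Proof.
rewrite /logistic opprK expRN; have := expR_gt0 x; move: (expR x) => e e0.
by field; apply/andP; split; apply: lt0r_neq0; rewrite ?ltr_pwDl.
Qed.

(** Both sides are invariant under [x -> - x], so [0 <= x] may be assumed; the minimum is then
    [1 - logistic x = logistic (- x)], whose inverse is [1 + expR x]. *)
Lemma inv_min_logistic x :
  (Num.min (logistic x) (1 - logistic x))^-1 = 1 + expR `|x|.
Proof.
wlog x0 : x / 0 <= x => [hw|].
  have [/hw//|/ltW x0] := leP 0 x.
  have := hw (- x); rewrite oppr_ge0 normrN => /(_ x0) <-.
  by rewrite logisticN subKr minC.
rewrite -logisticN (ger0_norm x0) min_r /logistic opprK ?invrK//.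
by rewrite lef_pV2 ?posrE ?addr_gt0 ?expR_gt0// lerD2l ler_expR ge0_cp.
Qed.

Lemma logitK u : 0 < u < 1 -> logistic (logit u) = u.
Proof.
move=> /andP[u0 u1]; have u1' : 0 < 1 - u by rewrite subr_gt0.
rewrite /logistic /logit expRN lnK ?posrE ?divr_gt0//.
by field; rewrite !lt0r_neq0//= addrC subrK.
Qed.

Lemma inv_min_logit u : 0 < u < 1 ->
  (Num.min u (1 - u))^-1 = 1 + expR `|logit u|.
Proof. by move=> u01; rewrite -inv_min_logistic logitK. Qed.

Lemma inv_min_ge1 u : 0 < u < 1 -> 1 <= (Num.min u (1 - u))^-1.
Proof. by move=> /inv_min_logit ->; rewrite lerDl expR_ge0. Qed.

(** By [inv_min_logistic] the claim compares [1 + expR |x|] with [expR M + expR (M + |y|)], term by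
    term: [0 <= M] and [|x| <= M + |y|]. *)
Lemma inv_min_logistic_le (M : R) x y : `|x - y| <= M ->
  (Num.min (logistic x) (1 - logistic x))^-1
    <= expR M * (Num.min (logistic y) (1 - logistic y))^-1.
Proof.
move=> xyM; have M0 : 0 <= M := le_trans (normr_ge0 _) xyM.
rewrite !inv_min_logistic mulrDr mulr1 lerD//; first by rewrite -expR0 ler_expR.
rewrite -expRD ler_expR.
by rewrite -lerBlDr (le_trans (lerB_dist _ _)).
Qed.

(** With [a = |logit u|], the left side is [ln (1 + expR a)], and [1 + expR a <= 2 * expR a] since
    [0 <= a]. *)
Lemma norm_ln_min_le u : 0 < u < 1 ->
  `|ln (Num.min u (1 - u))| <= `|logit u| + ln 2.
Proof.
move=> u01; have m1 := inv_min_ge1 u01.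
have m0 : 0 < Num.min u (1 - u) by rewrite -invr_gt0 (lt_le_trans ltr01).
rewrite -normrN -lnV ?posrE// ger0_norm ?ln_ge0// inv_min_logit//.
rewrite -[X in _ <= X + _]expRK -lnM ?posrE ?expR_gt0//.
rewrite ler_ln ?posrE ?mulr_gt0 ?addr_gt0 ?expR_gt0//.
by rewrite mulr_natr mulr2n lerD2r -expR0 ler_expR.
Qed.

End Logistic.

Theorem theorem15 (R : realType) (d N : nat) (hd : (0 < d)%N) (hN : (0 < N)%N)
    (v : 'rV[R]_d * R -> 'rV[R]_d)
    (v_smooth : smooth_on_slab v) (v_bounded : bounded_derivatives v) :
  let tau := transport v N in
  let F := @logistic R in
  (exists2 C4 : R, 0 < C4 &
     (forall (j : 'I_d) (u : 'rV[R]_d), open_cube u ->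
        (Num.min (F (tau u 0 j)) (1 - F (tau u 0 j)))^-1
          <= C4 * (Num.min (u 0 j) (1 - u 0 j))^-1)
     /\
     (let B0 : R := 1 in
      forall (j : 'I_d) (u : 'rV[R]_d), open_cube u ->
        (Num.min (F (tau u 0 j)) (1 - F (tau u 0 j)))^-1
          <= C4 * \prod_(l < d) (Num.min (u 0 l) (1 - u 0 l)) `^ (- B0)))
  /\
  (exists C' : R,
     let C5 : R := 1 in
     forall (j : 'I_d) (u : 'rV[R]_d), open_cube u ->
       `|ln (Num.min (u 0 j) (1 - u 0 j))| - C' <= `|tau u 0 j| /\
       C5 * `|ln (Num.min (u 0 j) (1 - u 0 j))| - C' <= `|tau u 0 j|).
Proof.
move=> tau F; have [M vM] := bounded_derivatives_bounded v_bounded.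
have tauM j u : `|tau u 0 j - logit (u 0 j)| <= M by exact: transport_dist.
have tau_le (j : 'I_d) u : open_cube u ->
    (Num.min (F (tau u 0 j)) (1 - F (tau u 0 j)))^-1
      <= expR M * (Num.min (u 0 j) (1 - u 0 j))^-1.
  (* Compare with [y = logit (u 0 j)], which [logistic] sends back to [u 0 j]. *)
  by move=> u01; have := inv_min_logistic_le (tauM j u); rewrite logitK.
split.
  exists (expR M); first exact: expR_gt0.
  split=> [//|B0 j u u01]; apply: le_trans (tau_le j u u01) _.
  rewrite ler_wpM2l ?expR_ge0//.
  have powE l : Num.min (u 0 l) (1 - u 0 l) `^ (- B0) =
      (Num.min (u 0 l) (1 - u 0 l))^-1.
    by rewrite powRN powRr1// -invr_ge0 (le_trans ler01)// inv_min_ge1.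
  under eq_bigr do rewrite powE.
  (* Isolate the factor of index [j]; all the others are at least 1, so their product can only
     enlarge the bound. *)
  rewrite (bigD1 j)//= ler_peMr ?(le_trans ler01) ?inv_min_ge1//.
  by apply: (big_ind (fun x : R => 1 <= x)) => // [x y x1 y1|l _]; rewrite ?mulr_ege1 ?inv_min_ge1.
(* [M] pays for the displacement by the flow, [ln 2] for replacing [|ln (min)|] by [|logit|]. As
   [C5] is 1, the two conjuncts coincide. *)
exists (M + ln 2) => C5 j u u01; rewrite mul1r.
suff: `|ln (Num.min (u 0 j) (1 - u 0 j))| - (M + ln 2) <= `|tau u 0 j| by [].
rewrite lerBlDr (le_trans (norm_ln_min_le (u01 j)))// addrA lerD2r.
by rewrite -lerBlDl (le_trans (lerB_dist _ _))// distrC.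
Qed.
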